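(* Let $X$ be a separable metric space equipped with a locally finite Borel measure $\mu$ (not necessarily finite and not assumed to be invariant), and let $T:X\to X$ be a measurable map. Then for each $x\in X$, the inequalities $$\overline{R}(x,y)\geq \overline{d}_\mu(y)\quad\text{and}\quad \underline{R}(x,y)\geq \underline{d}_\mu(y)$$ hold for $\mu$-almost every $y\in X$.
   Context: $B(y,r)$ denotes the (open) ball with center $y$ and radius $r$. Locally finite means every point has a neighborhood of finite measure. First entrance time: $\tau_r(x,y)=\min\{n\in\mathbb{N}: n>0,\ T^n(x)\in B(y,r)\}$, with $\tau_r(x,y)=\infty$ if there is no such $n$. Recurrence indicators: $$\overline R(x,y)=\limsup_{r\to 0}\frac{\log \tau_r(x,y)}{-\log r},\qquad \underline R(x,y)=\liminf_{r\to 0}\frac{\log \tau_r(x,y)}{-\log r};$$ if $\tau_r(x,y)=\infty$ for some $r>0$, both $\overline R(x,y)$ and $\underline R(x,y)$ are set equal to $+\infty$. Local dimensions of $\mu$ at $y$: $$\overline d_\mu(y)=\limsup_{r\to 0}\frac{\log \mu(B(y,r))}{\log r},\qquad \underline d_\mu(y)=\liminf_{r\to 0}\frac{\log \mu(B(y,r))}{\log r},$$ with the convention $\log 0=-\infty$ (so both equal $+\infty$ if some ball around $y$ has measure zero). All these quantities take values in $[0,+\infty]$. A property holds for $\mu$-almost every $y$ if the set where it fails is contained in a Borel set of $\mu$-measure zero. *)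

(* Defs.v *)
From HB Require Import structures.
From mathcomp Require Import all_boot all_order all_algebra.
From mathcomp Require Import all_classical all_reals all_analysis.

Set Implicit Arguments.
Unset Strict Implicit.
Unset Printing Implicit Defensive.

Import Order.TTheory GRing.Theory Num.Theory.
Import numFieldTopology.Exports numFieldNormedType.Exports.

Local Open Scope classical_set_scope.
Local Open Scope ring_scope.

(* A measurableType must be pointed, hence so must a metric space that carries
   a measure; the point plays no other role and only rules out the empty space. *)
#[short(type="pmetricType")]
HB.structure Definition PointedMetric (K : numDomainType) :=
  { M of Pointed M & Metric K M }.

Notation borel X := (g_sigma_algebraType (@open X)).

Definition separable (X : topologicalType) : Prop :=
  exists2 S : set X, countable S & dense S.

Definition locally_finite (R : realType) (X : pmetricType R)
    (mu : set (borel X) -> \bar R) : Prop :=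
  forall y : X, exists U : set (borel X),
    [/\ nbhs y (U : set X), measurable U & (mu U < +oo)%E].

Section recurrence.
Context (R : realType) (X : metricType R).
Implicit Types (T : X -> X) (x y : X) (r : R).

Definition entrance_time T x y r : \bar R :=
  if pselect (exists n, (0 < n)%N && `[< ball y r (iter n T x) >]) is left ex
  then (ex_minn ex)%:R%:E else +oo%E.

(* [lne] is the logarithm on [\bar R]: [lne 0 = -oo] and [lne +oo = +oo]. The
   radius tends to 0 through positive values ([0^'+]). *)
Definition upper_recurrence T x y : \bar R :=
  if `[< exists2 r, 0 < r & entrance_time T x y r = +oo%E >] then +oo%E
  else limf_esup (fun r => lne (entrance_time T x y r) / (- ln r)%:E)%E 0^'+.

Definition lower_recurrence T x y : \bar R :=
  if `[< exists2 r, 0 < r & entrance_time T x y r = +oo%E >] then +oo%E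
  else limf_einf (fun r => lne (entrance_time T x y r) / (- ln r)%:E)%E 0^'+.

Definition upper_local_dim (mu : set X -> \bar R) y : \bar R :=
  limf_esup (fun r => lne (mu (ball y r)) / (ln r)%:E)%E 0^'+.

Definition lower_local_dim (mu : set X -> \bar R) y : \bar R :=
  limf_einf (fun r => lne (mu (ball y r)) / (ln r)%:E)%E 0^'+.

End recurrence.

(* Main.v *)
(* If, at a point y, an exponent of the recurrence rate lies below the one of
   the local dimension, then for some rationals p < q there are arbitrarily
   small r such that T^n x is in B(y, r) for some n <= r^(-p) while
   mu (B(y, e^2 r)) <= (e^2 r)^q: of the two conditions one holds for all small
   radii and the other one infinitely often, so they can be met at the radii r
   and e^2 r simultaneously. For e^(-k-1) < r <= e^(-k), the ball B(T^n x, e^(-k))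
   contains y and is contained in B(y, e^2 r). Hence y lies in the union of those
   balls B(T^n x, e^(-k)), n <= e^(p (k + 1)), whose measure is at most
   e^(q (2 - k)); this union has measure O(e^(- (q - p) k)), and the
   Borel-Cantelli lemma applies. *)
Require Import Defs.
From mathcomp Require Import all_boot all_order all_algebra.
From mathcomp Require Import all_classical all_reals all_analysis.
From mathcomp Require Import ring lra.

Import Order.TTheory GRing.Theory Num.Theory.
Import numFieldNormedType.Exports.

Local Open Scope classical_set_scope.
Local Open Scope ring_scope.
Local Open Scope ereal_scope.

(** * Balls, rational gaps, and limits as the radius tends to zero *)

Lemma open_metric_ball {R : realFieldType} {X : metricType R} (x : X) (r : R) :
  open (ball x r).
Proof.
rewrite openE => y; rewrite ballEmdist /= => xyr.
apply/nbhs_ballP; exists (r - mdist x y)%R => /=; first by rewrite subr_gt0.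
move=> z; rewrite !ballEmdist /= => yz.
by rewrite (le_lt_trans (metric_triangle _ y _))// -ltrBrDl.
Qed.

Lemma measurable_metric_ball {R : realFieldType} {X : pmetricType R} (x : X)
    (r : R) : measurable (ball x r : set (borel X)).
Proof. by apply: sub_sigma_algebra; exact: open_metric_ball. Qed.

Lemma lte_rat_between {R : realType} {x y : \bar R} :
  x < y -> exists q : rat, x < (ratr q)%:E < y.
Proof.
move=> xy.
have [a [b [ab xa yb]]] : exists a b : R, [/\ (a < b)%R, x <= a%:E & b%:E <= y].
  case: x y xy => [x| |] [y| |] // xy.
  - by exists x, y; split.
  - by exists x, (x + 1)%R; split; rewrite ?leey// ltrDl.
  - by exists (y - 1)%R, y; split; rewrite ?leNye// ltrBlDr ltrDl.
  - by exists 0%R, 1%R; split; rewrite ?leey ?leNye.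
have [q] := rat_in_itvoo ab; rewrite in_itv/= => /andP[aq qb].
by exists q; rewrite (le_lt_trans xa) ?lte_fin// (lt_le_trans _ yb) ?lte_fin.
Qed.

Lemma near_limf_esup_lt {R : realType} {Z : choiceType} {T : filteredType Z}
    {f : T -> \bar R} {F : set_system T} {FF : Filter F} {a : \bar R} :
  limf_esup f F < a -> \forall x \near F, f x < a.
Proof.
rewrite limf_esupE => /ereal_inf_lt[_ [A FA <-]] sa.
apply: filterS FA => x Ax; apply: le_lt_trans sa.
by apply: ereal_sup_ubound; exists x.
Qed.

Lemma near_lt_limf_einf {R : realType} {Z : choiceType} {T : filteredType Z}
    {f : T -> \bar R} {F : set_system T} {FF : Filter F} {a : \bar R} :
  a < limf_einf f F -> \forall x \near F, a < f x.
Proof.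
rewrite limf_einfE => /ereal_sup_gt[_ [A FA <-]] sa.
apply: filterS FA => x Ax; apply: lt_le_trans sa _.
by apply: ereal_inf_lbound; exists x.
Qed.

Lemma frequently_lt_limf_esup {R : realType} {Z : choiceType}
    {T : filteredType Z} {f : T -> \bar R} {F : set_system T} {a : \bar R} :
  a < limf_esup f F -> forall A, F A -> exists2 x, A x & a < f x.
Proof.
rewrite limf_esupE => af A FA.
have : a < ereal_sup (f @` A).
  by apply: lt_le_trans af _; apply: ereal_inf_lbound; exists A.
by move=> /ereal_sup_gt[_ [x Ax <-]] afx; exists x.
Qed.

Lemma frequently_limf_einf_lt {R : realType} {Z : choiceType}
    {T : filteredType Z} {f : T -> \bar R} {F : set_system T} {a : \bar R} :
  limf_einf f F < a -> forall A, F A -> exists2 x, A x & f x < a.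
Proof.
rewrite limf_einfE => af A FA.
have : ereal_inf (f @` A) < a.
  by apply: le_lt_trans af; apply: ereal_sup_ubound; exists A.
by move=> /ereal_inf_lt[_ [x Ax <-]] afx; exists x.
Qed.

(** Passes between the radii [r] and [e^2 r], at which the two conditions are tested. *)
Lemma near0_right_scale {R : numFieldType} {c : R} {P : set R} : (0 < c)%R ->
  (\forall r \near 0%R^'+, P r) -> \forall r \near 0%R^'+, P (c * r)%R.
Proof.
move=> c0 [e /= e0 eP]; exists (e / c)%R => /=; first by rewrite divr_gt0.
move=> r /=; rewrite sub0r normrN => rec r0.
apply: eP; rewrite /= ?mulr_gt0//.
by rewrite sub0r normrN normrM gtr0_norm// mulrC -ltr_pdivlMr.
Qed.

(** * Borel-Cantelli and countable unions of null sets *)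

Lemma lim_sup_set_geometric {d} {T : measurableType d} {R : realType}
    (mu : {measure set T -> \bar R}) (E : (set T)^nat) (a z : R) :
  (forall k, measurable (E k)) -> (0 < z < 1)%R ->
  (forall k, mu (E k) <= (a * z ^+ k)%:E) -> mu (lim_sup_set E) = 0.
Proof.
move=> mE /andP[z0 z1] Eaz; apply: lim_sup_set_cvg0 => //.
(* The bound at [k = 0] forces this sign, which keeps the partial sums below the limit
   [a / (1 - z)]. *)
have a0 : (0 <= a)%R.
  have := le_trans (measure_ge0 mu (E 0%N)) (Eaz 0%N).
  by rewrite lee_fin expr0 mulr1.
apply: (@le_lt_trans _ _ (a * (1 - z)^-1)%:E); last exact: ltry.
apply: lime_le; first exact: is_cvg_nneseries.
apply: nearW => n; apply: (@le_trans _ _ (series (geometric a z) n)%:E).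
  by rewrite /series/= -sumEFin; apply: lee_sum => k _; exact: Eaz.
by rewrite lee_fin geometric_le_lim// gtr0_norm.
Qed.

Lemma negligible_bigcup_count {d} {T : measurableType d} {R : realFieldType}
    {mu : {measure set T -> \bar R}} {I : countType} (F : I -> set T) :
  (forall i, mu.-negligible (F i)) -> mu.-negligible (\bigcup_i F i).
Proof.
move=> F0; have : mu.-negligible (\bigcup_n oapp F set0 (unpickle n)).
  apply: negligible_bigcup => n; case: unpickle => [i|] /=; first exact: F0.
  exact: negligible_set0.
by apply: negligibleS => y [i _ Fy]; exists (pickle i); rewrite ?pickleK.
Qed.

(** * Covers by light balls *)

(* Keeping a ball only when its measure is at most c makes the set measurable
   without knowing that the measure of a ball depends measurably on its
   center. *)
Definition light_ball {R : realType} {X : pmetricType R}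
    (mu : set (borel X) -> \bar R) (c : R) (z : X) (r : R) : set (borel X) :=
  [set y | mu (ball z r) <= c%:E /\ ball z r y].

(* If exp (- (k + 1)) < r <= exp (- k), an index n.+1 <= r ^ (- a) is at most
   exp (a * (k + 1)), and a measure at most (exp 2 * r) ^ b is at most
   exp (b * (2 - k)). *)
Definition light_ball_cover {R : realType} {X : pmetricType R}
    (mu : set (borel X) -> \bar R) (u : nat -> X) (a b : R) (k : nat) :
    set (borel X) :=
  \bigcup_(n < Num.truncn (expR (a * k.+1%:R)))
    light_ball mu (expR (b * (2 - k%:R))) (u n) (expR (- k%:R)).

Section light_ball_cover.
Context {R : realType} {X : pmetricType R}.
Context (mu : {measure set (borel X) -> \bar R}) (u : nat -> X).
Implicit Types (a b c r : R) (k n : nat) (y z : X).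

Lemma light_ballE c z r :
  light_ball mu c z r = if mu (ball z r) <= c%:E then ball z r else set0.
Proof.
by case: ifPn => [small|/negP large]; apply/seteqP; split => // y; case.
Qed.

Lemma measurable_light_ball c z r : measurable (light_ball mu c z r).
Proof.
rewrite light_ballE; case: ifP => _; last exact: measurable0.
exact: measurable_metric_ball.
Qed.

Lemma measure_light_ball c z r : (0 <= c)%R -> mu (light_ball mu c z r) <= c%:E.
Proof.
by move=> c0; rewrite light_ballE; case: ifPn; rewrite // measure0 lee_fin.
Qed.

Lemma measurable_light_ball_cover a b k :
  measurable (light_ball_cover mu u a b k).
Proof. by apply: bigcup_measurable => n _; exact: measurable_light_ball. Qed.

(** There are at most [exp (a (k + 1))] balls, each contributing at most [exp (b (2 - k))]; the
    exponents add up to [(a + 2 b) + k (a - b)]. *)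
Lemma measure_light_ball_cover a b k :
  mu (light_ball_cover mu u a b k) <=
  (expR (a + 2 * b) * expR (a - b) ^+ k)%:E.
Proof.
set N := Num.truncn (expR (a * k.+1%:R)).
pose c : R := expR (b * (2 - k%:R)).
pose F n := light_ball mu c (u n) (expR (- k%:R)).
rewrite /light_ball_cover (bigcup_mkord _ F).
apply: (@le_trans _ _ (\sum_(n < N) mu (F n))).
  by apply: (Boole_inequality mu) => n _; exact: measurable_light_ball.
apply: (@le_trans _ _ (\sum_(n < N) c%:E)).
  by apply: lee_sum => n _; apply: measure_light_ball; exact: expR_ge0.
rewrite sumEFin lee_fin big_const_ord iter_addr_0.
rewrite -[leLHS]mulr_natl -expRM_natl -expRD.
have -> : (a + 2 * b + k%:R * (a - b) = a * k.+1%:R + b * (2 - k%:R))%R.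
  by rewrite -natr1; ring.
by rewrite expRD ler_pM2r ?expR_gt0// truncn_le expR_ge0.
Qed.

Lemma measure_lim_sup_light_ball_cover a b : (a < b)%R ->
  mu (lim_sup_set (light_ball_cover mu u a b)) = 0.
Proof.
move=> ab.
apply: (lim_sup_set_geometric mu _ (expR (a + 2 * b)) (expR (a - b))).
- exact: measurable_light_ball_cover.
- by rewrite expR_gt0 expR_lt1 subr_lt0.
- exact: measure_light_ball_cover.
Qed.

Lemma mem_light_ball_cover a b r n y :
  (0 <= a)%R -> (0 <= b)%R -> (0 < r < 1)%R ->
  ball y r (u n) -> (n.+1%:R <= expR (a * - ln r))%R ->
  mu (ball y (expR 2 * r)) <= (expR (b * ln (expR 2 * r)))%:E ->
  light_ball_cover mu u a b (Num.truncn (- ln r)%R) y.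
Proof.
move=> a0 b0 /andP[r0 r1] yu nr mur.
have t0 : (0 <= - ln r)%R by rewrite oppr_ge0 ln_le0// ltW.
have := truncn_itv t0; set k := Num.truncn _ => /andP[kt tk].
have rk : (r <= expR (- k%:R))%R.
  by rewrite -[leLHS]lnK ?posrE// ler_expR lerNr.
have kr : (expR (- k%:R) <= expR 1 * r)%R.
  rewrite -[in leRHS](@lnK _ r) ?posrE// -expRD ler_expR.
  by move: tk; rewrite -natr1; lra.
(* Being below the truncation means [n + 1 <= exp (a (k + 1))], which follows from
   [- ln r < k + 1]. *)
exists n => /=.
  rewrite truncn_gt_nat (le_trans nr)// ler_expR ler_wpM2l// ltW//.
split; last by apply: (le_ball rk); exact: ball_sym.
apply: (@le_trans _ _ (mu (ball y (expR 2 * r)))).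
  (* Points of the ball around [u n] are within [r + e^-k <= (1 + e) r] of [y], and [1 + e <= e^2]
     since [e >= 2]. *)
  apply: le_measure; rewrite ?inE; [exact: measurable_metric_ball..|].
  move=> z uz; apply: (@le_ball _ _ _ (r + expR (- k%:R))%R);
    last exact: ball_triangle uz.
  have e2 : (2 <= expR 1 :> R)%R by have := @expR_ge1Dx R 1%R; lra.
  have -> : (expR 2 = expR 1 * expR 1 :> R)%R by rewrite -expRD.
  nra.
apply: le_trans mur _; rewrite lee_fin ler_expR ler_wpM2l//.
by rewrite lnM ?posrE ?expR_gt0// expRK; lra.
Qed.

End light_ball_cover.

(** * From logarithmic quotients to bounds at one radius *)

Lemma entrance_time_ratio_lt {R : realType} {X : metricType R} {T : X -> X}
    {x y : X} {a r : R} :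
  (0 < r < 1)%R -> lne (entrance_time T x y r) / (- ln r)%:E < a%:E ->
  (0 <= a)%R /\ exists n, ball y r (iter n.+1 T x) /\
                          (n.+1%:R <= expR (a * - ln r))%R.
Proof.
move=> r01; have t0 : (0 < - ln r)%R by rewrite oppr_gt0 ln_lt0.
rewrite inver gt_eqF// lte_pdivrMr//= /entrance_time.
case: pselect => [ex|_] //; case: ex_minnP => -[|n] //= /asboolP yn _.
rewrite lern0 /= -EFinM lte_fin => na.
have n_ge1 : (0 <= ln n.+1%:R :> R)%R by rewrite ln_ge0// ler1n.
(* An entrance time is at least 1, so [a] exceeds a nonnegative quotient. *)
split; first by rewrite -(pmulr_lge0 _ t0) (le_trans n_ge1)// ltW.
exists n; split => //.
by rewrite -[leLHS]lnK ?posrE ?ltr0n// ler_expR ltW.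
Qed.

Lemma local_dim_ratio_gt {R : realType} {b r : R} {m : \bar R} :
  (0 < r < 1)%R -> b%:E < lne m / (ln r)%:E -> m <= (expR (b * ln r))%:E.
Proof.
move=> r01; have t0 : (ln r < 0)%R by exact: ln_lt0.
rewrite inver lt_eqF// lte_ndivlMr// -EFinM.
case: m => [m| |] //= mb; last by rewrite leNye.
(* For [m = 0] the logarithm is [-oo] and carries no bound; positivity of [expR] suffices. *)
rewrite lee_fin; have [m0|m0] := leP m 0%R.
  by rewrite (le_trans m0)// expR_ge0.
move: mb; rewrite leNgt m0/= lte_fin => mb.
by rewrite -[leLHS]lnK ?posrE// ler_expR ltW.
Qed.

(** * Radii at which both conditions hold *)

Section exponent_gap.
Context {R : realType} {X : pmetricType R}.
Context (mu : {measure set (borel X) -> \bar R}) (T : X -> X) (x : X).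
Implicit Types (a b r s : R) (y : X).

Let hit y r := lne (entrance_time T x y r) / (- ln r)%:E.
Let dim y r := lne (mu (ball y r)) / (ln r)%:E.

Lemma lim_sup_light_ball_cover_frequently a b y : (a < b)%R ->
  (forall A : set R, (0 : R)%R^'+ A ->
     exists2 r, A r & hit y r < a%:E /\ b%:E < dim y (expR 2 * r)) ->
  lim_sup_set (light_ball_cover mu (fun n => iter n.+1 T x) a b) y.
Proof.
move=> ab often k _.
(* Below [e^-(k + 2)], both [r] and [e^2 r] are less than 1 and the index [truncn (- ln r)] is at
   least [k]. *)
have near_small : \forall r \near (0 : R)%R^'+,
    (0 < r)%R /\ (r < expR (- (k%:R + 2)))%R.
  apply: filterI; first exact: nbhs_right_gt.
  by apply: nbhs_right_lt; exact: expR_gt0.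
have [r [r0 rk] [ra rb]] := often _ near_small.
have lnr : (ln r < - (k%:R + 2))%R by rewrite -ltr_expR lnK.
have k0 : (0 <= k%:R :> R)%R by [].
have r1 : (r < 1)%R by rewrite (lt_trans rk)// expR_lt1; lra.
have er0 : (0 < expR 2 * r)%R by rewrite mulr_gt0// expR_gt0.
have er1 : (expR 2 * r < 1)%R.
  by rewrite -[ltLHS]lnK ?posrE// expR_lt1 lnM ?posrE ?expR_gt0// expRK; lra.
have r01 : (0 < r < 1)%R by rewrite r0.
have [a0 [n [yn na]]] := entrance_time_ratio_lt r01 ra.
exists (Num.truncn (- ln r)%R) => /=.
  by rewrite truncn_ge_nat; lra.
apply: (@mem_light_ball_cover _ _ _ _ _ _ _ n) => //.
- by lra.
- by apply: local_dim_ratio_gt rb; rewrite er0.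
Qed.

(** The entrance condition holds for all small radii; a small [s] meeting the dimension condition
    then gives [r = s / e^2]. *)
Lemma upper_recurrence_lt_frequently a b y :
  upper_recurrence T x y < a%:E -> b%:E < upper_local_dim mu y ->
  forall A : set R, (0 : R)%R^'+ A ->
    exists2 r, A r & hit y r < a%:E /\ b%:E < dim y (expR 2 * r).
Proof.
rewrite /upper_recurrence; case: ifPn => _ // Ra bd A A0.
have e2 : (0 < (expR 2)^-1 :> R)%R by rewrite invr_gt0 expR_gt0.
have near_hit : \forall r \near (0 : R)%R^'+, A r /\ hit y r < a%:E.
  by apply: filterI => //; exact: near_limf_esup_lt Ra.
have [s [As sa] sb] :=
  frequently_lt_limf_esup bd _ (near0_right_scale e2 near_hit).
by exists ((expR 2)^-1 * s)%R => //; rewrite mulVKf ?gt_eqF ?expR_gt0.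
Qed.

(** Here the dimension condition holds for all small radii, and the entrance condition selects
    [r]. *)
Lemma lower_recurrence_lt_frequently a b y :
  lower_recurrence T x y < a%:E -> b%:E < lower_local_dim mu y ->
  forall A : set R, (0 : R)%R^'+ A ->
    exists2 r, A r & hit y r < a%:E /\ b%:E < dim y (expR 2 * r).
Proof.
rewrite /lower_recurrence; case: ifPn => _ // Ra bd A A0.
have e2 : (0 < expR 2 :> R)%R by exact: expR_gt0.
have near_dim : \forall r \near (0 : R)%R^'+, b%:E < dim y (expR 2 * r).
  by apply: (near0_right_scale (P := fun r => b%:E < dim y r) e2);
    exact: near_lt_limf_einf bd.
have near_A : \forall r \near (0 : R)%R^'+, A r /\ b%:E < dim y (expR 2 * r).
  exact: filterI.
by have [r [Ar rb] ra] := frequently_limf_einf_lt Ra _ near_A; exists r.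
Qed.

End exponent_gap.

Theorem theorem6 (R : realType) (X : pmetricType R)
    (mu : {measure set (borel X) -> \bar R}) (T : X -> X) :
  separable X ->
  locally_finite mu ->
  measurable_fun [set: borel X] (T : borel X -> borel X) ->
  forall x : X,
    {ae mu, forall y : X,
      upper_recurrence T x y >= upper_local_dim mu y /\
      lower_recurrence T x y >= lower_local_dim mu y}.
Proof.
move=> _ _ _ x.
(* Rational exponents leave countably many exceptional sets. The orbit starts at [T x] because
   entrance times are positive. *)
pose bad (pq : rat * rat) : set (borel X) :=
  if (pq.1 < pq.2)%R then
    lim_sup_set (light_ball_cover mu (fun n => iter n.+1 T x)
      (ratr pq.1) (ratr pq.2))
  else set0.
have bad0 pq : mu.-negligible (bad pq).
  rewrite /bad; case: ifPn => [pq_lt|_]; last exact: negligible_set0.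
  apply/negligibleP; last first.
    by apply: measure_lim_sup_light_ball_cover; rewrite ltr_rat.
  apply: bigcap_measurable => // n _; apply: bigcup_measurable => k _.
  exact: measurable_light_ball_cover.
have := negligible_bigcup_count bad bad0.
apply: negligibleS => y /= /not_andP gap.
have [p [q [pq often]]] : exists p q : rat, (p < q)%R /\
    (forall A : set R, (0 : R)%R^'+ A ->
      exists2 r, A r &
        lne (entrance_time T x y r) / (- ln r)%:E < (ratr p)%:E /\
        (ratr q)%:E < lne (mu (ball y (expR 2 * r))) / (ln (expR 2 * r))%:E).
  (* Either failing inequality leaves a gap; [p] is chosen in it first, then [q] between [p] and the
     local dimension. *)
  case: gap => /negP;
    rewrite -ltNge => /lte_rat_between[p /andP[Rp /lte_rat_between[q]]];
    rewrite lte_fin ltr_rat => /andP[pq qd]; exists p, q; split => //.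
  - exact: upper_recurrence_lt_frequently.
  - exact: lower_recurrence_lt_frequently.
exists (p, q) => //; rewrite /bad pq.
by apply: lim_sup_light_ball_cover_frequently; rewrite ?ltr_rat.
Qed.
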